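(* Let $\lambda\in\mathbb{C}$ and let $\mathcal{R}_\lambda\subset\mathbb{C}[x,y]$ be the ring of polynomials whose partial derivatives $q_x,q_y,q_{xy}$ vanish identically on the curve $\{(z,\lambda/z)\}$. Then $\mathcal{R}_\lambda$ has the form $$\mathcal{R}_\lambda=\mathbb{C}\left[\omega_1(xy-\lambda)^3,\ \omega_2(xy-\lambda)^3,\ \ldots\right],$$ where $\{\omega_i\}$ is any basis of $\mathbb{C}[x,y]$ as a vector space over $\mathbb{C}$. In particular, $\mathcal{R}_\lambda$ is not finitely generated (as a ring over $\mathbb{C}$).
   Context: For $\lambda\in\mathbb{C}$, $$\mathcal{R}_\lambda=\left\{q(x,y)\in\mathbb{C}[x,y] : q_x\left(z,\tfrac{\lambda}{z}\right)=q_y\left(z,\tfrac{\lambda}{z}\right)=q_{xy}\left(z,\tfrac{\lambda}{z}\right)\equiv 0\right\},$$ where subscripts denote partial derivatives and the identities hold identically in $z$ ($z\neq 0$). In the paper's words, $\mathcal{R}_\lambda$ is the set of polynomials $q\in\mathbb{C}[x,y]$ such that $q_x$, $q_y$ and $q_{xy}$ all have a factor of $xy-\lambda$. It is a subring of $\mathbb{C}[x,y]$ containing $\mathbb{C}$. The notation $\mathbb{C}[\nu_1,\nu_2,\ldots]$ means the $\mathbb{C}$-subalgebra of $\mathbb{C}[x,y]$ generated by the listed polynomials.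
   Formalization: The displayed form of R_λ is stated only for λ≠0, since at λ=0 it fails: y² lies in R_0 but not in C[ω_1(xy)³, ω_2(xy)³, …]; that R_λ is not finitely generated is stated for every λ. *)

(* Defs.v *)
From HB Require Import structures.
From mathcomp Require Import all_boot all_order all_algebra.
From mathcomp Require Import classical_sets reals.
From mathcomp Require Import complex mpoly.

Set Implicit Arguments.
Unset Strict Implicit.
Unset Printing Implicit Defensive.

Import GRing.Theory.

Local Open Scope classical_set_scope.
Local Open Scope ring_scope.

(* [mem S] is the (classically) boolean membership predicate of the set S. *)
Definition gen_subalg (K : pzRingType) (A : lalgType K) (G : set A) : set A :=
  smallest (fun S : set A => GRing.subalg_closed (mem S)) G.

Definition fin_gen_subalg (K : pzRingType) (A : lalgType K) (S : set A) : Prop :=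
  exists s : seq A, S = gen_subalg [set` s].

Definition lin_indep (K : pzRingType) (V : lmodType K) (I : eqType)
    (e : I -> V) : Prop :=
  forall (s : seq I) (c : I -> K), uniq s ->
    \sum_(i <- s) c i *: e i = 0 -> forall i, i \in s -> c i = 0.

Definition lin_spanning (K : pzRingType) (V : lmodType K) (I : eqType)
    (e : I -> V) : Prop :=
  forall v : V, exists (s : seq I) (c : I -> K), v = \sum_(i <- s) c i *: e i.

(* Algebraic (Hamel) basis, as an indexed family; I may be infinite. *)
Definition is_basis (K : pzRingType) (V : lmodType K) (I : eqType)
    (e : I -> V) : Prop :=
  lin_indep e /\ lin_spanning e.

Section BivariatePolynomials.
Variable R : realType.
Local Notation C := R[i].

Definition varx : 'I_2 := ord0.
Definition vary : 'I_2 := ord_max.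

Definition curve_pt (lambda z : C) : 'I_2 -> C := tnth [tuple z; lambda / z].

Definition vanishes_on_curve (lambda : C) (p : {mpoly C[2]}) : Prop :=
  forall z : C, z != 0 -> p.@[curve_pt lambda z] = 0.

(* At lambda = 0 the curve is only the punctured line y = 0, not the whole zero
   locus of x * y, and Rlam 0 = C + y^2 C[x,y] contains y^2, which is not in
   C + (x y)^3 C[x,y]. *)
Definition Rlam (lambda : C) : set {mpoly C[2]} :=
  [set q | [/\ vanishes_on_curve lambda (q^`M(varx)),
               vanishes_on_curve lambda (q^`M(vary))
             & vanishes_on_curve lambda (q^`M(varx)^`M(vary)) ] ].

Definition curve_eq (lambda : C) : {mpoly C[2]} :=
  'X_varx * 'X_vary - lambda%:MP.

End BivariatePolynomials.

(* Main.v *)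
Require Import Defs.
From mathcomp Require Import all_boot all_order all_algebra.
From mathcomp Require Import classical_sets reals.
From mathcomp Require Import complex mpoly.
From mathcomp Require Import ring.

Local Open Scope classical_set_scope.
Local Open Scope ring_scope.

Import GRing.Theory Num.Theory.

(** Write f = x y - lambda. The proof describes Rlam lambda as C + d C[x,y] for
    an explicit d vanishing on the curve: d = f^3 when lambda != 0
    ([Rlam_neq0]) and d = y^2 when lambda = 0 ([Rlam_0]).

    Everything rests on one reduction ([reduce_mod_curve]): since x y is
    congruent to lambda modulo f, multiplying q by a high power of x makes it
    congruent modulo f to a polynomial in x alone, which is determined by its
    values on the curve. Two facts follow.
    - If q vanishes on the curve and lambda != 0, then f divides q: x is
      invertible modulo f, with inverse y / lambda
      ([vanishes_dvd_curve_eq]). For lambda = 0 the curve is only the punctured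
      x-axis, and the conclusion is that y divides q ([vanishes_dvdy]).
    - If q_x and q_y vanish on the curve, then q is constant on it
      ([constant_on_curve]), because the vector field x d/dx - y d/dy, which
      is tangent to the curve, kills q there.
    For lambda != 0, an element of Rlam lambda is therefore c + f g; the
    vanishing of q_x on the curve makes g divisible by f, and that of q_xy
    makes the next quotient divisible by f as well. For lambda = 0, q is
    c + y g and the vanishing of q_y makes g divisible by y.

    The products omega_i d span d C[x,y], and C + d C[x,y] is a subalgebra, so
    they generate it ([scalars_plus_ideal_gen]).

    For the failure of finite generation ([scalars_plus_ideal_not_fg]), observe
    that in a product (b + d k) (c + d h) = b c + d (b h + c k + d k h) the
    cofactor restricts to b h + c k on the curve. Restrictions to the curve of
    the cofactors occurring in a finitely generated subalgebra thus stay in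
    the span of those of the generators, hence are Laurent polynomials in z of
    bounded degree, whereas the cofactor x^M of d x^M restricts to z^M. *)

(** * Subalgebras and polynomials *)

Lemma subalg_closedP (K : pzRingType) (A : lalgType K) (S : set A) :
  GRing.subalg_closed (mem S) <->
  [/\ S 1, forall (a : K) u v, S u -> S v -> S (a *: u + v)
    & forall u v, S u -> S v -> S (u * v)].
Proof.
split=> [[S1 SZ SM]|[S1 SZ SM]].
  split; first exact/set_mem.
    by move=> a u v Su Sv; apply/set_mem/SZ; exact/mem_set.
  by move=> u v Su Sv; apply/set_mem/SM; exact/mem_set.
split; first exact/mem_set.
  by move=> a u v Su Sv; apply/mem_set/SZ; exact/set_mem.
by move=> u v Su Sv; apply/mem_set/SM; exact/set_mem.
Qed.

Lemma gen_subalg_closed (K : pzRingType) (A : lalgType K) (G : set A) :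
  GRing.subalg_closed (mem (gen_subalg G)).
Proof.
apply/subalg_closedP; split.
- by move=> S [/subalg_closedP[]].
- move=> a u v Gu Gv S SG; have /subalg_closedP[_ + _] := SG.1.
  by apply; [exact: Gu | exact: Gv].
- move=> u v Gu Gv S SG; have /subalg_closedP[_ _ +] := SG.1.
  by apply; [exact: Gu | exact: Gv].
Qed.

(** Induction along the ring operations instead of along monomials: a property
    of all polynomials need only be followed through a sum and through the
    multiplication by one variable. *)
Lemma mpoly_ring_ind (n : nat) (K : comNzRingType) (P : {mpoly K[n]} -> Prop) :
  (forall c, P c%:MP) -> (forall p q, P p -> P q -> P (p + q)) ->
  (forall i p, P p -> P ('X_i * p)) -> forall p, P p.
Proof.
move=> PC PD PX; elim/mpolyind => [|c m p _ _ Pp]; first by rewrite -mpolyC0.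
apply: PD => //; rewrite -mul_mpolyC mpolyXE_id.
elim: (index_enum _) => [|i s IHs]; first by rewrite big_nil mulr1.
rewrite big_cons mulrCA; elim: (m i) => [|k IHk]; first by rewrite mul1r.
by rewrite exprS -mulrA; apply: PX.
Qed.

Lemma mderivXU (n : nat) (K : comNzRingType) (i j : 'I_n) :
  ('X_j : {mpoly K[n]})^`M(i) = (i == j)%:R.
Proof.
rewrite mderivX mnm1E eq_sym; case: eqP => [->|_]; last by rewrite scale0r.
by rewrite -{1}[U_(j)%MM]add0m addmK mpolyX0 scale1r.
Qed.

Lemma poly_eq0_off0 (K : numFieldType) (p : {poly K}) :
  (forall z, z != 0 -> p.[z] = 0) -> p = 0.
Proof.
move=> p0; apply/eqP/negPn/negP => /max_poly_roots.
move=> /(_ [seq i.+1%:R | i <- iota 0 (size p)]).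
rewrite size_map size_iota ltnn => abs; apply: notF; apply: abs.
  by apply/allP => _ /mapP[i _ ->]; apply/eqP/p0; rewrite pnatr_eq0.
by rewrite map_inj_uniq ?iota_uniq // => i j /eqP; rewrite eqr_nat => /eqP[].
Qed.

(** * Polynomials modulo the curve *)

Section Curve.
Local Set Implicit Arguments.
Local Unset Strict Implicit.
Variable R : realType.
Local Notation C := R[i].
Local Notation B := {mpoly C[2]}.
Local Notation x := ('X_varx : B).
Local Notation y := ('X_vary : B).
Implicit Types (lambda z c : C) (p q k h d : B) (P Q : {poly C}).

Lemma curve_ptx lambda z : curve_pt lambda z varx = z.
Proof. by []. Qed.

Lemma curve_pty lambda z : curve_pt lambda z vary = lambda / z.
Proof. by []. Qed.

Lemma bipoly_ind (T : B -> Prop) :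
  (forall c, T c%:MP) -> (forall p q, T p -> T q -> T (p + q)) ->
  (forall p, T p -> T (x * p)) -> (forall p, T p -> T (y * p)) ->
  forall p, T p.
Proof.
move=> TC TD Tx Ty; apply: mpoly_ring_ind => // i p Tp.
have /orP[/eqP->|/eqP->] : (i == varx) || (i == vary); last 2 first.
- exact: Tx.
- exact: Ty.
by case: i => -[|[|//]] ?; rewrite -!val_eqE.
Qed.

Lemma curve_eq_vanishes lambda : vanishes_on_curve lambda (curve_eq lambda).
Proof.
move=> z z0; rewrite mevalB mevalM !mevalXU mevalC curve_ptx curve_pty.
by rewrite mulrC divfK ?subrr.
Qed.

Lemma mderiv_curve_eqx lambda : (curve_eq lambda)^`M(varx) = y.
Proof. by rewrite mderivB mderivC mderivM !mderivXU /= mul1r mulr0 addr0 subr0. Qed.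

Lemma mderiv_curve_eqy lambda : (curve_eq lambda)^`M(vary) = x.
Proof. by rewrite mderivB mderivC mderivM !mderivXU /= mul0r mulr1 add0r subr0. Qed.

(** Writing Q(x) as the image of Q under an algebra morphism provides its
    compatibility with sums, products and powers. *)
Definition xpoly Q : B := horner_alg x Q.

Lemma xpolyC c : xpoly c%:P = c%:MP.
Proof. by rewrite /xpoly horner_algC -mul_mpolyC mulr1. Qed.

Lemma xpolyMX Q : xpoly (Q * 'X) = xpoly Q * x.
Proof. by rewrite /xpoly rmorphM /= horner_algX. Qed.

Lemma xpolyD P Q : xpoly (P + Q) = xpoly P + xpoly Q.
Proof. by rewrite /xpoly rmorphD. Qed.

Lemma xpolyM P Q : xpoly (P * Q) = xpoly P * xpoly Q.
Proof. by rewrite /xpoly rmorphM. Qed.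

Lemma xpolyXn n : xpoly 'X^n = x ^+ n.
Proof. by rewrite /xpoly rmorphXn /= horner_algX. Qed.

Lemma meval_xpoly v Q : (xpoly Q).@[v] = Q.[v varx].
Proof.
elim/poly_ind: Q => [|Q c IH]; first by rewrite -(polyC0 C) xpolyC mevalC hornerC.
by rewrite xpolyD xpolyMX xpolyC mevalD mevalM mevalC mevalXU IH hornerMXaddC.
Qed.

Lemma mderiv_xpolyx Q : (xpoly Q)^`M(varx) = xpoly Q^`().
Proof.
elim/poly_ind: Q => [|Q c IH].
  by rewrite -(polyC0 C) derivC !xpolyC mderivC.
rewrite xpolyD xpolyMX xpolyC mderivD mderivM mderivC mderivXU IH eqxx mulr1.
by rewrite derivD derivM derivC derivX mulr1 !addr0 xpolyD xpolyMX.
Qed.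

Lemma mderiv_xpolyy Q : (xpoly Q)^`M(vary) = 0.
Proof.
elim/poly_ind: Q => [|Q c IH]; first by rewrite -(polyC0 C) !xpolyC mderivC.
rewrite xpolyD xpolyMX xpolyC mderivD mderivM mderivC mderivXU IH.
by rewrite mul0r mulr0 !addr0.
Qed.

(** Each factor y met in q is paid for by one factor x, since x y = lambda + f.
    The curve may be the degenerate one, lambda = 0. *)
Lemma reduce_mod_curve lambda q :
  exists N Q h, x ^+ N * q = xpoly Q + curve_eq lambda * h.
Proof.
elim/bipoly_ind: q => [c|p q [N [P [h e]]] [M [Q [k e']]]|q [N [Q [h e]]]
  |q [N [Q [h e]]]].
- by exists 0%N, c%:P, 0; rewrite xpolyC mul1r mulr0 addr0.
- exists (N + M)%N, ('X^M * P + 'X^N * Q), (x ^+ M * h + x ^+ N * k).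
  rewrite xpolyD !xpolyM !xpolyXn exprD.
  transitivity (x ^+ M * (x ^+ N * p) + x ^+ N * (x ^+ M * q)); first by ring.
  by rewrite e e'; ring.
- by exists N, (Q * 'X), (x * h); rewrite xpolyMX mulrCA e; ring.
- exists N.+1, (lambda%:P * Q), (lambda%:MP * h + x ^+ N * q).
  rewrite xpolyM xpolyC exprS.
  transitivity (lambda%:MP * (x ^+ N * q) + curve_eq lambda * (x ^+ N * q)).
    by rewrite /curve_eq; ring.
  by rewrite {1}e; ring.
Qed.

(** Reduction gives x^N q = Q(x) + f h, and Q vanishes at all nonzero z, so that
    f divides x^N q. The powers of x are removed one at a time with
    lambda p = y (x p) - f p. *)
Lemma vanishes_dvd_curve_eq lambda q : lambda != 0 ->
  vanishes_on_curve lambda q -> exists h, q = curve_eq lambda * h.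
Proof.
move=> l0 q0; have [N [Q [h e]]] := reduce_mod_curve lambda q.
have Q0 : Q = 0.
  apply: poly_eq0_off0 => z z0; have /(congr1 (meval (curve_pt lambda z))) := e.
  rewrite mevalM q0 // mulr0 mevalD mevalM curve_eq_vanishes // mul0r addr0.
  by rewrite meval_xpoly curve_ptx.
move: e; rewrite Q0 -(polyC0 C) xpolyC mpolyC0 add0r.
elim: N h => [|N IH] h; first by rewrite mul1r; exists h.
rewrite exprS -mulrA => e.
apply: (IH (lambda^-1%:MP * (y * h - x ^+ N * q))).
have lK : lambda^-1%:MP * lambda%:MP = 1 :> B by rewrite -mpolyCM mulVf.
rewrite -[LHS]mul1r -lK -mulrA.
transitivity (lambda^-1%:MP * (y * (x * (x ^+ N * q))
   - curve_eq lambda * (x ^+ N * q))); first by rewrite /curve_eq; ring.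
by rewrite e; ring.
Qed.

(** Write q = Q(x) + y h: on the punctured x-axis q takes the values of Q, so
    Q = 0. *)
Lemma vanishes_dvdy q :
  vanishes_on_curve 0 q -> exists h, q = y * h.
Proof.
move=> q0.
have [Q [h e]] : exists Q h, q = xpoly Q + y * h.
  elim/bipoly_ind: q {q0} => [c|p q [P [h ->]] [Q [k ->]]|q [Q [h ->]]|q _].
  - by exists c%:P, 0; rewrite xpolyC mulr0 addr0.
  - by exists (P + Q), (h + k); rewrite xpolyD; ring.
  - by exists (Q * 'X), (x * h); rewrite xpolyMX; ring.
  - by exists 0, q; rewrite -(polyC0 C) xpolyC add0r.
have Q0 : Q = 0.
  apply: poly_eq0_off0 => z z0; have := q0 z z0.
  rewrite e mevalD mevalM mevalXU curve_pty mul0r mul0r addr0.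
  by rewrite meval_xpoly curve_ptx.
by exists h; rewrite e Q0 -(polyC0 C) xpolyC add0r.
Qed.

(** From x^N q = Q(x) + f h one gets z^N q = Q(z) on the curve. Applying the
    tangent derivation x d/dx - y d/dy to the same equation gives
    N z^N q = z Q'(z), as q_x and q_y vanish. Hence N Q = X Q', which
    forces Q = c X^N, and q = c on the curve. *)
Lemma constant_on_curve lambda q :
  vanishes_on_curve lambda (q^`M(varx)) ->
  vanishes_on_curve lambda (q^`M(vary)) ->
  exists c, vanishes_on_curve lambda (q - c%:MP).
Proof.
move=> qx0 qy0.
move: (curve_eq lambda) (@curve_eq_vanishes lambda) (mderiv_curve_eqx lambda)
  (mderiv_curve_eqy lambda) (reduce_mod_curve lambda q) => f f0 fx fy.
move=> [N [Q [h e]]].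
have eQ z : z != 0 -> z ^+ N * q.@[curve_pt lambda z] = Q.[z].
  move=> z0; have /(congr1 (meval (curve_pt lambda z))) := e.
  rewrite mevalM mevalD mevalM f0 // mul0r addr0.
  by rewrite meval_xpoly rmorphXn /= mevalXU.
have eQ' : Q *+ N = Q^`() * 'X.
  apply/subr0_eq/poly_eq0_off0 => z z0.
  rewrite hornerD hornerN hornerMn hornerMX -eQ //.
  have /(congr1 (meval (curve_pt lambda z))) := congr1 (mderiv varx) e.
  rewrite -xpolyXn mderivM mderivD mderivM !mderiv_xpolyx fx.
  rewrite !(mevalD, mevalM) f0 // qx0 // !meval_xpoly curve_ptx.
  rewrite mul0r mulr0 !addr0 mevalXU curve_pty => ex.
  (* As f_y = x does not vanish on the curve, the y-derivative of the equation
     gives h = 0 there, which turns the x-derivative into the claim. *)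
  have /(congr1 (meval (curve_pt lambda z))) := congr1 (mderiv vary) e.
  rewrite -xpolyXn mderivM mderivD mderivM !mderiv_xpolyy fy.
  rewrite !(mevalD, mevalM) f0 // qy0 // mevalXU !meval0 curve_ptx.
  rewrite !(mul0r, mulr0, addr0, add0r) => /esym/eqP.
  rewrite mulf_eq0 (negPf z0) /= => /eqP h0.
  move: ex; rewrite h0 mulr0 addr0 => <-.
  rewrite derivXn hornerMn hornerXn -mulrnAl mulrAC; apply/eqP; rewrite subr_eq0.
  case: (N) => [|n]; first by rewrite !mulr0n !mul0r.
  by rewrite /= exprSr !mulrnAl.
exists Q`_N => z z0; apply: (mulfI (expf_neq0 N z0)).
rewrite mevalB mevalC mulr0 mulrBr eQ //.
suff -> : Q = Q`_N *: 'X^N.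
  by rewrite coefZ coefXn eqxx mulr1 hornerZ hornerXn mulrC subrr.
apply/polyP => i; rewrite coefZ coefXn.
have [->|iN] := eqVneq i N; first by rewrite mulr1.
rewrite mulr0; have /polyP/(_ i) := eQ'.
rewrite coefMn coefMX coef_deriv; case: i iN => [|i] iN /=.
  by move/eqP; rewrite mulrn_eq0 eq_sym (negPf iN) => /eqP.
move/eqP; rewrite -subr_eq0 -mulr_natr -[_ *+ i.+1]mulr_natr -mulrBr mulf_eq0.
by rewrite subr_eq0 eqr_nat [N == _]eq_sym (negPf iN) orbF => /eqP.
Qed.

(** * The structure of the ring *)

Lemma vanishesMl lambda p q : vanishes_on_curve lambda p ->
  vanishes_on_curve lambda (p * q).
Proof. by move=> p0 z z0; rewrite mevalM p0 ?mul0r. Qed.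

Definition scalars_plus_ideal d : set B :=
  [set q | exists c k, q = c%:MP + d * k].

(** Modulo f, the x-derivative of c + f g is y g and the mixed derivative of
    c + f^2 h is 2 x y h = 2 lambda h. Since y and lambda do not vanish on the
    curve, each condition yields one more factor f. Conversely, derivatives of
    order at most two of f^3 k keep a factor f. *)
Lemma Rlam_neq0 lambda : lambda != 0 ->
  Rlam lambda = scalars_plus_ideal (curve_eq lambda ^+ 3).
Proof.
move=> l0.
move: (curve_eq lambda) (@curve_eq_vanishes lambda) (mderiv_curve_eqx lambda)
  (mderiv_curve_eqy lambda) (@vanishes_dvd_curve_eq lambda ^~ l0).
move=> f f0 fx fy f_dvd.
apply/seteqP; split=> [q [qx qy qxy]|_ [c [k ->]]].
  have [c /f_dvd[g eg]] := constant_on_curve qx qy.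
  have {eg}eq : q = c%:MP + f * g by rewrite -eg addrC subrK.
  have [h eh] : exists h, g = f * h.
    apply: f_dvd => z z0; have := qx z z0.
    rewrite eq mderivD mderivC mderivM fx add0r mevalD !mevalM f0 // mul0r addr0.
    rewrite mevalXU curve_pty => /eqP.
    by rewrite !mulf_eq0 invr_eq0 (negPf l0) (negPf z0) => /eqP.
  have [k ek] : exists k, h = f * k.
    apply: f_dvd => z z0; have := qxy z z0.
    have -> : q^`M(varx) = f * (y * h + (y * h + f * h^`M(varx))).
      by rewrite eq eh mderivD mderivC !mderivM fx; ring.
    rewrite mderivM fy mevalD [(f * _).@[_]]mevalM f0 // mul0r addr0.
    rewrite !(mevalM, mevalD, mevalXU) f0 // mul0r addr0 curve_ptx curve_pty.
    rewrite -mulr2n mulrnAr mulrA [z * _]mulrC divfK // => /eqP.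
    by rewrite mulrn_eq0 mulf_eq0 (negPf l0) => /eqP.
  by exists c, k; rewrite eq eh ek; ring.
have fsq p : vanishes_on_curve lambda (f * p) by exact: vanishesMl.
split.
- have -> : (c%:MP + f ^+ 3 * k)^`M(varx) = f * (f * (3%:R * y * k + f * k^`M(varx))).
    by rewrite mderivD mderivC !exprS expr0 mulr1 !mderivM fx; ring.
  exact: fsq.
- have -> : (c%:MP + f ^+ 3 * k)^`M(vary) = f * (f * (3%:R * x * k + f * k^`M(vary))).
    by rewrite mderivD mderivC !exprS expr0 mulr1 !mderivM fy; ring.
  exact: fsq.
- set g := 3%:R * y * k + f * k^`M(varx).
  have -> : (c%:MP + f ^+ 3 * k)^`M(varx) = f * (f * g).
    by rewrite mderivD mderivC !exprS expr0 mulr1 !mderivM fx /g; ring.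
  have -> : (f * (f * g))^`M(vary) = f * (2%:R * x * g + f * g^`M(vary)).
    by rewrite !mderivM fy; ring.
  exact: fsq.
Qed.

(** The x-derivative of c + y^2 k keeps the factor y^2, because y does not
    depend on x, so its y-derivative vanishes for y = 0 without any further
    condition on k; this is why the exponent is two instead of three. *)
Lemma Rlam_0 : Rlam (0 : C) = scalars_plus_ideal (y ^+ 2).
Proof.
have yx : y^`M(varx) = 0 by rewrite mderivXU.
have yy : y^`M(vary) = 1 by rewrite mderivXU.
have y0 p : vanishes_on_curve 0 (y * p).
  by move=> z z0; rewrite mevalM mevalXU curve_pty !mul0r.
apply/seteqP; split=> [q [qx qy _]|_ [c [k ->]]].
  have [c /vanishes_dvdy[g eg]] := constant_on_curve qx qy.
  have {eg}eq : q = c%:MP + y * g by rewrite -eg addrC subrK.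
  have [h eh] : exists h, g = y * h.
    apply: vanishes_dvdy => z z0; have := qy z z0.
    by rewrite eq mderivD mderivC mderivM yy add0r mul1r mevalD y0 // addr0.
  by exists c, h; rewrite eq eh; ring.
have ex : (c%:MP + y ^+ 2 * k)^`M(varx) = y * (y * k^`M(varx)).
  by rewrite mderivD mderivC expr2 !mderivM yx; ring.
split.
- by rewrite ex.
- have -> : (c%:MP + y ^+ 2 * k)^`M(vary) = y * (2%:R * k + y * k^`M(vary)).
    by rewrite mderivD mderivC expr2 !mderivM yy; ring.
  exact: y0.
- rewrite ex mderivM yy mderivM yy.
  have -> : forall g h, 1 * (y * g) + y * (1 * g + y * h) = y * (2%:R * g + y * h).
    by move=> g h; ring.
  exact: y0.
Qed.

(** The family omega_i d spans the ideal linearly, and the right-hand side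
    cannot be larger because C + d C[x,y] is itself closed under products. *)
Lemma scalars_plus_ideal_gen d (I : eqType) (omega : I -> B) :
  lin_spanning omega ->
  scalars_plus_ideal d = gen_subalg [set omega i * d | i in [set: I]].
Proof.
move=> span; apply/seteqP; split=> [_ [c [k ->]]|].
  set G := gen_subalg _.
  have /subalg_closedP[G1 GZ _] : GRing.subalg_closed (mem G).
    exact: gen_subalg_closed.
  have G0 : G 0 by have := GZ (-1) _ _ G1 G1; rewrite scaleN1r addNr.
  have [s [a ->]] := span k.
  have -> : c%:MP = c *: 1 :> B by rewrite -mul_mpolyC mulr1.
  apply: (GZ) => //; rewrite mulr_sumr.
  elim: s => [|i s IH]; first by rewrite big_nil.
  rewrite big_cons -scalerAr mulrC; apply: (GZ) => //.
  by apply: sub_gen_smallest; exists i.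
apply: smallest_sub => [|_ [i _ <-]]; last first.
  by exists 0, (omega i); rewrite mpolyC0 add0r mulrC.
apply/subalg_closedP; split.
- by exists 1, 0; rewrite mulr0 addr0.
- move=> a _ _ [b [k ->]] [c [h ->]]; exists (a * b + c), (a%:MP * k + h).
  by rewrite -mul_mpolyC mpolyCD mpolyCM; ring.
- move=> _ _ [b [k ->]] [c [h ->]].
  exists (b * c), (b%:MP * h + c%:MP * k + d * k * h).
  by rewrite mpolyCM; ring.
Qed.

(** * Failure of finite generation *)

(** The Laurent polynomial k(z, lambda / z) has degrees between - M and M - 1.
    These bounds define an increasing sequence of subspaces exhausting
    C[x,y]. *)
Definition bounded_on_curve lambda (M : nat) k : Prop :=
  exists2 Q : {poly C}, (size Q <= M.*2)%N
    & forall z, z != 0 -> z ^+ M * k.@[curve_pt lambda z] = Q.[z].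

Lemma bounded_on_curveS lambda M k :
  bounded_on_curve lambda M k -> bounded_on_curve lambda M.+1 k.
Proof.
move=> [Q sQ eQ]; exists (Q * 'X); last first.
  by move=> z z0; rewrite hornerMX -eQ // exprS -mulrA mulrC.
by apply: leq_trans (size_polyMleq _ _) _; rewrite size_polyX addn2 /= doubleS ltnS ltnW.
Qed.

Lemma bounded_on_curve_le lambda M N k : (M <= N)%N ->
  bounded_on_curve lambda M k -> bounded_on_curve lambda N k.
Proof.
move=> /subnKC <-; elim: (N - M)%N => [|n IH]; first by rewrite addn0.
by move=> /IH/bounded_on_curveS; rewrite addnS.
Qed.

Lemma bounded_on_curve_ex lambda k : exists M, bounded_on_curve lambda M k.
Proof.
have [N [Q [h e]]] := reduce_mod_curve lambda k.
exists (N + size Q)%N, ('X^(size Q) * Q).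
  apply: leq_trans (size_polyMleq _ _) _.
  by rewrite size_polyXn /= -addnn leq_add // leq_addl.
move=> z z0; rewrite hornerM hornerXn addnC exprD -mulrA; congr (_ * _).
have /(congr1 (meval (curve_pt lambda z))) := e.
rewrite mevalM mevalD mevalM curve_eq_vanishes // mul0r addr0.
by rewrite meval_xpoly rmorphXn /= mevalXU.
Qed.

Lemma bounded_on_curve_lin lambda M a k h :
  bounded_on_curve lambda M k -> bounded_on_curve lambda M h ->
  bounded_on_curve lambda M (a *: k + h).
Proof.
move=> [P sP eP] [Q sQ eQ]; exists (a *: P + Q).
  rewrite (leq_trans (size_polyD _ _)) // geq_max sQ andbT.
  exact: leq_trans (size_scale_leq _ _) sP.
by move=> z z0; rewrite hornerD hornerZ -eP // -eQ // mevalD mevalZ; ring.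
Qed.

(** Applied to multiples of d: the quadratic term of a product does not affect
    the bound. *)
Lemma bounded_on_curve_van lambda M k :
  vanishes_on_curve lambda k -> bounded_on_curve lambda M k.
Proof.
move=> k0; exists 0; first by rewrite size_poly0.
by move=> z z0; rewrite k0 // mulr0 horner0.
Qed.

Lemma unbounded_on_curve lambda M : ~ bounded_on_curve lambda M (x ^+ M).
Proof.
move=> [Q sQ eQ].
have QE : Q = 'X^(M.*2).
  apply/subr0_eq/poly_eq0_off0 => z z0.
  rewrite hornerD hornerN hornerXn -eQ // rmorphXn /= mevalXU curve_ptx.
  by rewrite -exprD addnn subrr.
by move: sQ; rewrite QE size_polyXn ltnn.
Qed.

(** The elements c + d k with k bounded by M form a subalgebra S M, and finitely
    many generators all lie in S M for some M. But d x^M does not lie in S M,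
    because d != 0 makes the cofactor unique once c is known to be 0. *)
Lemma scalars_plus_ideal_not_fg lambda d :
  d != 0 -> vanishes_on_curve lambda d ->
  ~ fin_gen_subalg (scalars_plus_ideal d).
Proof.
move=> dn0 d0 [s es].
pose S M := [set q | exists c k, q = c%:MP + d * k
                     /\ bounded_on_curve lambda M k].
have S_closed M : GRing.subalg_closed (mem (S M)).
  apply/subalg_closedP; split.
  - exists 1, 0; split; first by rewrite mulr0 addr0.
    by apply: bounded_on_curve_van => z _; rewrite meval0.
  - move=> a _ _ [b [k [-> kb]]] [c [h [-> hb]]].
    exists (a * b + c), (a *: k + h); split; last exact: bounded_on_curve_lin.
    by rewrite -!mul_mpolyC mpolyCD mpolyCM; ring.
  - move=> _ _ [b [k [-> kb]]] [c [h [-> hb]]].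
    exists (b * c), (b *: h + (c *: k + d * (k * h))); split.
      by rewrite -!mul_mpolyC mpolyCM; ring.
    do 2 apply: bounded_on_curve_lin => //.
    exact/bounded_on_curve_van/vanishesMl.
have [M sM] : exists M, forall q, q \in s -> S M q.
  have : forall q, q \in s -> scalars_plus_ideal d q.
    by move=> q qs; rewrite es; apply: sub_gen_smallest.
  elim: s {es} => [|q s IH] sA; first by exists 0%N.
  have [|N sN] := IH; first by move=> p ps; apply: sA; rewrite inE ps orbT.
  have [c [k qE]] := sA q (mem_head _ _).
  have [L kL] := bounded_on_curve_ex lambda k.
  exists (L + N)%N => p; rewrite inE => /orP[/eqP->|/sN[a [h [-> hN]]]].
    by exists c, k; split=> //; apply: bounded_on_curve_le kL; exact: leq_addr.
  by exists a, h; split=> //; apply: bounded_on_curve_le hN; exact: leq_addl.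
have : scalars_plus_ideal d (d * x ^+ M).
  by exists 0, (x ^+ M); rewrite mpolyC0 add0r.
rewrite es => /(smallest_sub (S_closed M) sM)[c [k [e kM]]].
have c0 : c = 0.
  have /(congr1 (meval (curve_pt lambda 1))) := e.
  (* z = 1 gives a point of the curve for every lambda *)
  by rewrite mevalD mevalC !mevalM d0 ?oner_eq0 // !mul0r addr0.
apply: (@unbounded_on_curve lambda M); suff -> : x ^+ M = k by [].
by apply: (mulfI dn0); rewrite e c0 mpolyC0 add0r.
Qed.

Lemma curve_eq_neq0 lambda : curve_eq lambda != 0.
Proof.
apply/eqP => /(congr1 (mderiv vary)); rewrite mderiv_curve_eqy mderiv0 => /eqP.
by rewrite -msize_poly_eq0 msizeX.
Qed.

End Curve.

Theorem lemma2p3 (R : realType) (lambda : R[i]) :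
  (lambda != 0 ->
   forall (I : eqType) (omega : I -> {mpoly R[i][2]}), is_basis omega ->
     Rlam lambda =
     gen_subalg [set omega i * curve_eq lambda ^+ 3 | i in [set: I]])
  /\ ~ fin_gen_subalg (Rlam lambda).
Proof.
split=> [l0 I omega [_ span]|].
  by rewrite Rlam_neq0 //; exact: scalars_plus_ideal_gen.
have [->|l0] := eqVneq lambda 0.
  rewrite Rlam_0; apply: (@scalars_plus_ideal_not_fg R 0).
    by rewrite expf_neq0 // -msize_poly_eq0 msizeX.
  by apply: vanishesMl => z z0; rewrite mevalXU curve_pty mul0r.
rewrite Rlam_neq0 //; apply: (@scalars_plus_ideal_not_fg R lambda).
  by rewrite expf_neq0 // curve_eq_neq0.
exact/vanishesMl/curve_eq_vanishes.
Qed.
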